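(* Let $x_1,\dots,x_n\in\mathbb{R}^{m_x}$ satisfy $\|x_i\|^2-x_i^\top x_j>0$ for all $i\ne j$. Let $H\ge2$, and let $h_X^{(H)}$ be the last-hidden-layer output map of the fully-connected network with softplus activation $\sigma$ and layer widths $m_1,\dots,m_H$ (defined in the context). Assume $\min(m_1,\dots,m_{H-1})\ge\min(m_x,n)$ and $m_H\ge n$. Then there exists $w_{(1:H)}\in\mathbb{R}^{d_{1:H}}$ such that $$\det\big([h_X^{(H)}(w_{(1:H)}),\mathbf{1}_n]\,[h_X^{(H)}(w_{(1:H)}),\mathbf{1}_n]^\top\big)\neq0.$$
   Context: Softplus: $\sigma(z)=\ln(1+\exp(\varsigma z))/\varsigma$ with an arbitrary fixed hyperparameter $\varsigma>0$, applied entrywise to vectors. Fully-connected network: for $l=1,\dots,H$, with $m_0:=m_x$, weight matrices $W^{(l)}\in\mathbb{R}^{m_{l-1}\times m_l}$ and biases $b^{(l)}\in\mathbb{R}^{1\times m_l}$, $$h^{(0)}(x_i)=x_i^\top\in\mathbb{R}^{1\times m_x},\qquad h^{(l)}(x_i,w_{(1:l)})=\sigma\big(h^{(l-1)}(x_i,w_{(1:l-1)})W^{(l)}+b^{(l)}\big)\in\mathbb{R}^{1\times m_l},$$ where $w_{(1:l)}$ is the vector of all entries of $W^{(1)},b^{(1)},\dots,W^{(l)},b^{(l)}$, and $\mathbb{R}^{d_{1:H}}$ is the space of all parameters $w_{(1:H)}$. The matrix $h_X^{(H)}(w_{(1:H)})\in\mathbb{R}^{n\times m_H}$ has $i$-th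 row $h^{(H)}(x_i,w_{(1:H)})$. $\mathbf{1}_n\in\mathbb{R}^n$ is the all-ones column vector. *)

(* Defs.v *)
From mathcomp Require Import all_boot all_order all_algebra.
From mathcomp Require Import reals sequences exp.

Set Implicit Arguments.
Unset Strict Implicit.
Unset Printing Implicit Defensive.

Import Order.TTheory GRing.Theory Num.Theory.
Local Open Scope ring_scope.

Definition softplus (R : realType) (s z : R) : R := ln (1 + expR (s * z)) / s.

Definition dotp (R : realType) (d : nat) (u v : 'cV[R]_d) : R :=
  (u^T *m v) 0 0.

(* Euclidean norm; the norm that the library puts on matrices is the sup norm. *)
Definition enorm (R : realType) (d : nat) (u : 'cV[R]_d) : R :=
  Num.sqrt (\sum_(k < d) u k 0 ^+ 2).

(* A width sequence [m : nat -> nat] has [m 0] = m_x (the input dimension) and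
   [m l] = m_l; a network of depth [H] only depends on [m 0], ..., [m H].
   [nparams m l] is the dimension of the vector w_(1:l) of all entries of
   W^(1), b^(1), ..., W^(l), b^(l). *)
Fixpoint nparams (m : nat -> nat) (l : nat) : nat :=
  if l is k.+1 then (nparams m k + (m k * m k.+1 + m k.+1))%N else 0%N.

(* w_(1:k) as the initial part of w_(1:k+1); the rest of w_(1:k+1) consists of
   the entries of W^(k+1) (in row-major order), then those of b^(k+1). *)
Definition prev_params (R : realType) (m : nat -> nat) (k : nat)
    (w : 'rV[R]_(nparams m k.+1)) : 'rV[R]_(nparams m k) :=
  lsubmx w.

Definition weight (R : realType) (m : nat -> nat) (k : nat)
    (w : 'rV[R]_(nparams m k.+1)) : 'M[R]_(m k, m k.+1) :=
  vec_mx (lsubmx (rsubmx (w : 'rV_(nparams m k + (m k * m k.+1 + m k.+1))))).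

Definition bias (R : realType) (m : nat -> nat) (k : nat)
    (w : 'rV[R]_(nparams m k.+1)) : 'rV[R]_(m k.+1) :=
  rsubmx (rsubmx (w : 'rV_(nparams m k + (m k * m k.+1 + m k.+1)))).

Fixpoint layer (R : realType) (s : R) (m : nat -> nat) (x : 'cV[R]_(m 0%N))
    (l : nat) : 'rV[R]_(nparams m l) -> 'rV[R]_(m l) :=
  match l with
  | 0 => fun _ => x^T
  | k.+1 => fun w =>
      map_mx (softplus s) (layer s x (prev_params w) *m weight w + bias w)
  end.

Definition layer_mx (R : realType) (s : R) (m : nat -> nat) (n : nat)
    (x : 'I_n -> 'cV[R]_(m 0%N)) (l : nat) (w : 'rV[R]_(nparams m l))
    : 'M[R]_(n, m l) :=
  \matrix_(i < n) layer s (x i) w.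

(* Main.v *)
Require Import Defs.
From mathcomp Require Import all_boot all_order all_algebra.
From mathcomp Require Import reals sequences exp.
From mathcomp Require Import ring lra.

Set Implicit Arguments.
Unset Strict Implicit.
Unset Printing Implicit Defensive.

Import Order.TTheory GRing.Theory Num.Theory.
Local Open Scope ring_scope.

(** Say that a hidden layer separates the data if, for each [i], some linear
    functional takes a larger value at the [i]-th output than at every other
    output.  The hypothesis on the inputs gives this for the input layer, with
    the functionals [x_i].  Let [d] be the minimum of [m_x] and [n]; the
    functionals factor through [R^d] (directly if [d = m_x], by using the
    functionals themselves as coordinates if [d = n]).  A layer of width at
    least [d] can carry these [d] coordinates: with a large bias [B], softplus
    is uniformly close to the translation by [B] on the finitely many values
    concerned, so the strict inequalities survive.  In the last layer, unit [i]
    computes softplus of a large multiple of the [i]-th functional, shifted to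
    be nonpositive at all data points but the [i]-th.  The resulting square matrix
    is diagonally dominant. *)

(** * Iterated minima and linear algebra *)

Lemma bigmin_nat_leq (I : eqType) (r : seq I) (F : I -> nat) (c : nat) (i : I) :
  i \in r -> (\big[minn/c]_(j <- r) F j <= F i)%N.
Proof.
elim: r => // j r IHr; rewrite inE big_cons geq_min => /predU1P[->|/IHr ->].
  by rewrite leqnn.
by rewrite orbT.
Qed.

Lemma mulmx_pid_widen (R : pzSemiRingType) (p q d : nat) (le_dq : (d <= q)%N)
    (M : 'M[R]_(p, q)) (i : 'I_p) (k : 'I_d) :
  (M *m (pid_mx d : 'M_(q, d))) i k = M i (widen_ord le_dq k).
Proof.
rewrite mxE (bigD1 (widen_ord le_dq k)) //= mxE /= eqxx ltn_ord mulr1.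
rewrite big1 ?addr0 // => j nejk; rewrite mxE.
suff -> : (j == k :> nat) = false by rewrite mulr0.
by apply: contraNF nejk => /eqP ejk; apply/eqP/val_inj.
Qed.

(** If [v *m N = 0] with [v] nonzero, the column indexed by an entry of [v] of maximal modulus
    contradicts dominance. *)
Lemma diag_dominant_unitmx (R : realFieldType) (n : nat) (N : 'M[R]_n) :
  (forall i, \sum_(j | j != i) `|N j i| < `|N i i|) -> N \in unitmx.
Proof.
move=> domN; rewrite -row_free_unit -kermx_eq0; apply/rowV0P => v /sub_kermxP vN0.
apply/rowP => i0; rewrite [RHS]mxE; apply/eqP; apply: contraT => vi0_neq0.
pose i := [arg max_(i > i0) `|v 0 i|]%O.
have vmax j : `|v 0 j| <= `|v 0 i|.
  by rewrite /i; case: (@arg_maxP _ _ _ i0) => // k _; apply.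
have vi_gt0 : 0 < `|v 0 i| by apply: lt_le_trans (vmax i0); rewrite normr_gt0.
have /eqP := congr1 (fun u : 'rV_n => u 0 i) vN0.
rewrite !mxE (bigD1 i) //= addr_eq0 => /eqP /(congr1 Num.norm).
rewrite normrN normrM => eN.
have : `|v 0 i| * `|N i i| <= `|v 0 i| * \sum_(j | j != i) `|N j i|.
  rewrite eN mulr_sumr (le_trans (ler_norm_sum _ _ _)) //.
  by apply: ler_sum => j _; rewrite normrM ler_wpM2r.
by rewrite ler_pM2l // leNgt domN.
Qed.

(** If [v] kills the Gram matrix, then [v *m A] has squared length zero, hence vanishes. *)
Lemma row_free_gram (R : realFieldType) (p q : nat) (A : 'M[R]_(p, q)) :
  row_free A -> \det (A *m A^T) != 0.
Proof.
move=> freeA; rewrite -unitfE -[_ \is a _]/(_ \in unitmx) -row_free_unit.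
rewrite -kermx_eq0; apply/rowV0P => v /sub_kermxP vAA0.
have : (v *m A) *m (v *m A)^T = 0 by rewrite trmx_mul !mulmxA -(mulmxA v) vAA0 mul0mx.
move=> /matrixP /(_ 0 0); rewrite [RHS]mxE mxE => /eqP.
rewrite psumr_eq0 => [|j _]; last by rewrite [_^T _ _]mxE -expr2 sqr_ge0.
move=> /allP vA0; apply: (row_free_inj freeA); rewrite mul0mx.
apply/rowP => j; move: (vA0 j); rewrite mem_index_enum [_^T _ _]mxE -expr2.
by move=> /(_ isT); rewrite sqrf_eq0 => /eqP ->; rewrite mxE.
Qed.

(** * Estimates for softplus *)

Section Softplus.
Variables (R : realType) (s : R).
Hypothesis s_gt0 : 0 < s.

Lemma softplus_gt0 (z : R) : 0 < softplus s z.
Proof. by rewrite divr_gt0 // ln_gt0 // ltrDl expR_gt0. Qed.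

Lemma softplus_le (y z : R) : y <= z -> softplus s y <= softplus s z.
Proof.
move=> yz; rewrite /softplus ler_pM2r ?invr_gt0 //.
rewrite ler_ln ?posrE ?addr_gt0 ?expR_gt0 //.
by rewrite lerD2l ler_expR ler_pM2l.
Qed.

Lemma softplusE (z : R) : softplus s z = z + softplus s (- z).
Proof.
rewrite /softplus.
have -> : 1 + expR (s * z) = expR (s * z) * (1 + expR (s * - z)) :> R.
  by rewrite mulrDr mulr1 -expRD mulrN subrr expR0 addrC.
rewrite lnM ?posrE ?addr_gt0 ?expR_gt0 // expRK mulrDl mulrAC divff ?mul1r //.
by rewrite gt_eqF.
Qed.

Lemma softplus_le_expR (z : R) : softplus s z <= expR (s * z) / s.
Proof.
rewrite ler_pM2r ?invr_gt0 // le_ln1Dx //.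
by rewrite (lt_trans _ (expR_gt0 _)) ?ltrN10.
Qed.

Lemma softplus_near_translation (T e : R) : 0 < e ->
  exists B, forall y, `|y| <= T -> 0 <= softplus s (y + B) - (y + B) <= e.
Proof.
move=> e_gt0; exists (T - ln (s * e) / s) => y yT.
rewrite softplusE [_ + softplus _ _]addrC addrK ltW ?softplus_gt0 //=.
have le_ny : - (y + (T - ln (s * e) / s)) <= ln (s * e) / s.
  by move: yT; rewrite ler_norml => /andP[yT _]; lra.
apply: (le_trans (softplus_le le_ny)); apply: (le_trans (softplus_le_expR _)).
rewrite mulrCA divff ?gt_eqF // mulr1 lnK ?posrE ?mulr_gt0 //.
by rewrite mulrAC divff ?gt_eqF ?mul1r.
Qed.

(** * Separating matrices *)

(** [Z j i] stands for the value of the [i]-th functional at the [j]-th output; the margin is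
    normalised to 1. *)
Definition separating (n : nat) (Z : 'M[R]_n) :=
  forall i j, i != j -> 1 <= Z i i - Z j i.

(** The shift [B] cancels in differences of rows; the remaining error costs at most half of the
    margin, and doubling [A] restores it. *)
Lemma separating_softplus (n d : nat) (Y : 'M[R]_(n, d)) (A : 'M[R]_(d, n)) :
  separating (Y *m A) ->
  exists (B : R) (A' : 'M[R]_(d, n)),
    separating (map_mx (fun y => softplus s (y + B)) Y *m A').
Proof.
move=> sepY; pose S := \sum_i \sum_k `|A k i|.
have S_ge0 : 0 <= S by rewrite sumr_ge0 // => i _; rewrite sumr_ge0.
pose e := (2 * (S + 1))^-1.
have e_gt0 : 0 < e by rewrite invr_gt0; lra.
have eS : e * S <= 1 / 2.
  rewrite /e invfM -mulrA mul1r -[leRHS]mulr1 ler_pM2l ?invr_gt0 ?ltr0n //.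
  by rewrite mulrC ler_pdivrMr ?mul1r; lra.
have [B nearB] := softplus_near_translation (\sum_i \sum_k `|Y i k|) e_gt0.
exists B, (2 *: A) => i j neij; rewrite -scalemxAr !mxE -mulrBr.
pose E i k := softplus s (Y i k + B) - (Y i k + B).
have E_bound i' k : 0 <= E i' k <= e.
  apply: nearB; rewrite (bigD1 i') //= (bigD1 k) //= -addrA lerDl addr_ge0 //.
    by rewrite sumr_ge0.
  by rewrite sumr_ge0 // => *; rewrite sumr_ge0.
have := sepY _ _ neij; rewrite !mxE -!sumrB => sepij.
have -> : \sum_k (map_mx (fun y => softplus s (y + B)) Y i k * A k i
                  - map_mx (fun y => softplus s (y + B)) Y j k * A k i)
        = \sum_k (Y i k * A k i - Y j k * A k i)
          + \sum_k (E i k - E j k) * A k i.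
  by rewrite -big_split; apply: eq_bigr => k _; rewrite !mxE /E /=; ring.
have : `|\sum_k (E i k - E j k) * A k i| <= e * S.
  apply: (le_trans (ler_norm_sum _ _ _)).
  apply: (@le_trans _ _ (e * \sum_k `|A k i|)).
    rewrite mulr_sumr ler_sum // => k _; rewrite normrM ler_wpM2r // ler_norml.
    by have := E_bound i k; have := E_bound j k; lra.
  rewrite ler_pM2l // /S (bigD1 i) //= lerDl sumr_ge0 // => *.
  by rewrite sumr_ge0.
rewrite ler_norml; lra.
Qed.

Lemma separating_rescale (n d : nat) (Y : 'M[R]_(n, d)) (A : 'M[R]_(d, n)) :
  (forall i j, i != j -> (Y *m A) j i < (Y *m A) i i) ->
  exists c : R, separating (Y *m (c *: A)).
Proof.
(* A sum of inverse gaps dominates each of them, so it serves as a maximum. *)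
move=> sepY; exists (\sum_i \sum_(j | i != j) ((Y *m A) i i - (Y *m A) j i)^-1).
move=> i j neij; rewrite -scalemxAr mxE [X in _ - X]mxE -mulrBr.
have gap_ge0 i' j' : i' != j' -> 0 <= ((Y *m A) i' i' - (Y *m A) j' i')^-1.
  by move=> ne; rewrite invr_ge0 subr_ge0 ltW ?sepY.
have gap_gt0 : 0 < (Y *m A) i i - (Y *m A) j i by rewrite subr_gt0 sepY.
rewrite -ler_pdivrMr // div1r (bigD1 i) //= (bigD1 j) //= -addrA lerDl addr_ge0 //.
  by rewrite sumr_ge0 // => j' /andP[? _]; apply: gap_ge0.
by rewrite sumr_ge0 // => i' _; rewrite sumr_ge0 // => j'; apply: gap_ge0.
Qed.

(** In column [k] the argument of softplus is [c] on the diagonal and at most 0 elsewhere. The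
    off-diagonal sum is thus at most [softplus s 0 *+ n], which is [c], and [c < softplus s c]. *)
Lemma separating_unitmx (n : nat) (Z : 'M[R]_n) : separating Z ->
  exists (c : R) (b : 'rV[R]_n),
    (\matrix_(i, k) softplus s (c * Z i k + b 0 k)) \in unitmx.
Proof.
move=> sepZ; pose c := softplus s 0 *+ n.
have c_ge0 : 0 <= c by rewrite mulrn_wge0 // ltW ?softplus_gt0.
exists c, (\row_k (c - c * Z k k)); apply: diag_dominant_unitmx => k.
rewrite !mxE addrC subrK (ger0_norm (ltW (softplus_gt0 _))).
apply: (@le_lt_trans _ _ c); last by rewrite softplusE ltrDl softplus_gt0.
apply: (@le_trans _ _ (\sum_(j | j != k) softplus s 0)).
  apply: ler_sum => j nejk; rewrite !mxE (ger0_norm (ltW (softplus_gt0 _))).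
  apply: softplus_le; have := sepZ k j; rewrite eq_sym => /(_ nejk) gap.
  by have := ler_wpM2l c_ge0 gap; rewrite mulrBr mulr1; lra.
rewrite sumr_const; apply: ler_wpMn2l; first by rewrite ltW ?softplus_gt0.
by rewrite (leq_trans (max_card _)) ?card_ord.
Qed.

(** * Propagation through the network *)

Section Network.
Variables (m : nat -> nat) (n : nat) (x : 'I_n -> 'cV[R]_(m 0%N)).

(** The prescribed [W] and [b] are padded by zeros to the full width; [pid_mx d] on the right keeps
    the first [d] units. *)
Lemma layer_mxS_pid (l d : nat) (w : 'rV[R]_(nparams m l))
    (W : 'M[R]_(m l, d)) (b : 'rV[R]_d) : (d <= m l.+1)%N ->
  exists w' : 'rV[R]_(nparams m l.+1), layer_mx s x w' *m pid_mx d
    = \matrix_(i, k) softplus s ((layer_mx s x w *m W) i k + b 0 k).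
Proof.
move=> le_d; pose P : 'M[R]_(d, m l.+1) := pid_mx d.
have PK p (M : 'M[R]_(p, d)) i k : (M *m P) i (widen_ord le_d k) = M i k.
  by rewrite -mulmx_pid_widen -mulmxA mul_pid_mx !minnn (minn_idPr le_d) pid_mx_1 mulmx1.
exists (row_mx w (row_mx (mxvec (W *m P)) (b *m P))); apply/matrixP => i k.
rewrite mulmx_pid_widen mxE /= /prev_params /weight /bias.
rewrite !row_mxKr !row_mxKl mxvecK [LHS]mxE [RHS]mxE; congr (softplus s _).
rewrite [LHS]mxE mulmxA !PK; congr (_ + _).
by rewrite !mxE; apply: eq_bigr => j _; rewrite mxE.
Qed.

(** [C] extracts the [d] coordinates that the next layer has to carry. *)
Definition separable (d l : nat) :=
  exists (w : 'rV[R]_(nparams m l)) (C : 'M[R]_(m l, d)) (A : 'M[R]_(d, n)),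
    separating (layer_mx s x w *m C *m A).

Lemma separable_input :
  (forall i j : 'I_n, i != j -> enorm (x i) ^+ 2 - dotp (x i) (x j) > 0) ->
  separable (minn (m 0%N) n) 0.
Proof.
move=> hx; pose X : 'M[R]_(m 0%N, n) := \matrix_(k, i) x i k 0.
have XE (w : 'rV_(nparams m 0)) i j : (layer_mx s x w *m X) j i = dotp (x i) (x j).
  by rewrite /dotp !mxE; apply: eq_bigr => k _; rewrite !mxE mulrC.
have [c sepc] : exists c : R, separating (layer_mx s x (0 : 'rV_(nparams m 0)) *m (c *: X)).
  apply: separating_rescale => i j /hx; rewrite !XE subr_gt0; congr (_ < _).
  rewrite sqr_sqrtr ?sumr_ge0 // => [|k _]; last exact: sqr_ge0.
  by rewrite /dotp mxE; apply: eq_bigr => k _; rewrite mxE expr2.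
exists 0; case: leqP => _.
  by exists 1%:M, (c *: X); rewrite mulmx1.
by exists (c *: X), 1%:M; rewrite mulmx1.
Qed.

Lemma separableS (d l : nat) :
  (d <= m l.+1)%N -> separable d l -> separable d l.+1.
Proof.
move=> le_d [w [C [A /separating_softplus [B [A' sepA']]]]].
have [w' w'E] := layer_mxS_pid w C (const_mx B) le_d.
exists w', (pid_mx d), A'; rewrite w'E; congr (separating (_ *m _)): sepA'.
by apply/matrixP => i k; rewrite [LHS]mxE [RHS]mxE [const_mx _ _ _]mxE.
Qed.

Lemma separable_row_free (d l : nat) : (n <= m l.+1)%N -> separable d l ->
  exists w : 'rV[R]_(nparams m l.+1), row_free (layer_mx s x w).
Proof.
move=> le_n [w [C [A /separating_unitmx [c [b unitN]]]]].
have [w' w'E] := layer_mxS_pid w (c *: (C *m A)) b le_n.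
(* The first [n] columns form an invertible block, whose inverse yields a right inverse of the whole
   layer matrix. *)
exists w'; apply/row_freeP; exists (pid_mx n *m invmx (layer_mx s x w' *m pid_mx n)).
rewrite mulmxA mulmxV // w'E; congr (_ \in unitmx): unitN.
by apply/matrixP => i k; rewrite [LHS]mxE [RHS]mxE -scalemxAr mulmxA [in RHS]mxE.
Qed.

End Network.

End Softplus.

Theorem theorem2 (R : realType) (s : R) (hs : 0 < s)
    (n H : nat) (hH : (2 <= H)%N) (m : nat -> nat)
    (x : 'I_n -> 'cV[R]_(m 0%N))
    (hx : forall i j : 'I_n, i != j ->
            enorm (x i) ^+ 2 - dotp (x i) (x j) > 0)
    (hm : (\big[minn/m 1%N]_(1 <= l < H) m l >= minn (m 0%N) n)%N)
    (hmH : (m H >= n)%N) :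
  exists w : 'rV[R]_(nparams m H),
    let A : 'M[R]_(n, m H + 1) := row_mx (layer_mx s x w) (const_mx 1) in
    \det (A *m A^T) != 0.
Proof.
(* With [H] written as [l.+1], layers 1 to [l] preserve separability and layer [l.+1] gives full row
   rank. *)
case: H hH hm hmH => // l l_gt0 hm hmH.
have sep k : (k <= l)%N -> separable s x (minn (m 0%N) n) k.
  elim: k => [_|k IHk lt_kl]; first exact: separable_input.
  apply: separableS (IHk (ltnW lt_kl)) => //; apply: leq_trans hm _.
  by apply: bigmin_nat_leq; rewrite mem_index_iota.
have [w free_w] := separable_row_free hs hmH (sep l (leqnn l)).
exists w; apply: row_free_gram; apply/row_freeP.
have /row_freeP[D wD] := free_w.
(* The zero row of the right inverse cancels the column of ones. *)
by exists (col_mx D 0); rewrite mul_row_col mulmx0 addr0.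
Qed.
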